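(* Consider the conditionally Gaussian model of the context (with $\psi$ bounded). Let $N\ge1$, let $z_0,z_0'\in\mathcal{X}^N$, and let $v_k$, $v_k'$ be the particle ensembles of the Gaussianized optimal particle filter with $N$ particles, initialized at $z_0$ and $z_0'$ respectively, both defined with the same observational data $\{y^\dagger_k\}_{k\ge1}$. Let $q^k(z_0,\cdot)$ and $q^k(z_0',\cdot)$ denote the laws of $v_k$ and $v'_k$ on $\mathcal{X}^N$ given the data. Then there exists $\mathfrak{z}_N\in(0,1)$ such that, almost surely with respect to the randomness generating $\{y^\dagger_k\}_{k\ge1}$, $$\limsup_{k\to\infty}\Bigl(d_{\rm TV}\bigl(q^k(z_0,\cdot),q^k(z_0',\cdot)\bigr)\Bigr)^{1/k}\ \le\ \mathfrak{z}_N .$$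
   Context: $\mathcal{X}$ and $\mathcal{Y}$ are finite-dimensional Euclidean spaces. For symmetric positive definite $A$, $|\cdot|_A=|A^{-1/2}\cdot|$. The total variation metric on probability measures is $d_{\rm TV}(\mu,\nu)=\frac12\sup_{|h|\le1}|\mu(h)-\nu(h)|$, the supremum being over measurable functions bounded by $1$. Model. $\psi:\mathcal{X}\to\mathcal{X}$ is bounded (and measurable), $H:\mathcal{X}\to\mathcal{Y}$ is linear, and $$u_{k+1}=\psi(u_k)+\xi_k,\qquad y_{k+1}=Hu_{k+1}+\eta_{k+1},$$ with $\xi_k\sim N(0,\Sigma)$ i.i.d., $\eta_k\sim N(0,\Gamma)$ i.i.d., independent of each other and of the initial condition. Here $\Sigma=\sigma^2\Sigma_0$, $\Gamma=\gamma^2\Gamma_0$ with $\Sigma_0,\Gamma_0$ strictly positive definite, $\sigma,\gamma\in(0,\infty)$, $r:=\sigma/\gamma$. Set $$C^{-1}=\Sigma^{-1}+H^*\Gamma^{-1}H,\quad S=H\Sigma H^*+\Gamma,\quad K=\Sigma H^*S^{-1}.$$ Fixed data. Fix $u_0^\dagger\in\mathcal{X}$ and positive semi-definite matrices $\Sigma_*,\Gamma_*$ on $\mathcal{X},\mathcal{Y}$, and let $$u^\dagger_{k+1}=\psi(u^\dagger_k)+r\gamma\,\xi^\dagger_k,\qquad y^\dagger_{k+1}=Hu^\dagger_{k+1}+\gamma\,\eta^\dagger_{k+1},$$ with $\xi^\dagger_k\sim N(0,\Sigma_* )$ i.i.d., $\eta^\dagger_k\sim N(0,\Gamma_* )$ i.i.d.,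 the two sequences being independent. Gaussianized optimal particle filter (GOPF). The ensemble is $v_k=(v_k^{(1)},\dots,v_k^{(N)})\in\mathcal{X}^N$. Given data $\{y_k\}$ (here $y_k=y_k^\dagger$), $$\widetilde v_{k}^{(n)}=\sum_{m=1}^N \mathbb{I}_{I_{k+1}^{(m)}}(r_{k+1}^{(n)})\,v_{k}^{(m)},\quad r_{k+1}^{(n)}\sim U(0,1)\ \text{i.i.d.},$$ $$v_{k+1}^{(n)}=(I-KH)\psi(\widetilde v_k^{(n)})+Ky_{k+1}+\zeta_k^{(n)},\quad \zeta_k^{(n)}\sim N(0,C)\ \text{i.i.d.},$$ with weights $$w_{k+1}^{(n),*}=\exp\bigl(-\tfrac12|y_{k+1}-H\psi(v_k^{(n)})|_S^2\bigr),\quad w_{k+1}^{(n)}=\frac{w_{k+1}^{(n),*}}{\sum_{m=1}^Nw_{k+1}^{(m),*}},$$ and intervals $I_{k+1}^{(m)}=[\alpha_{k+1}^{(m-1)},\alpha_{k+1}^{(m)})$, $\alpha_{k+1}^{(0)}=0$, $\alpha_{k+1}^{(m)}=\alpha_{k+1}^{(m-1)}+w_{k+1}^{(m)}$, $m=1,\dots,N$ (so the $\widetilde v_{k}^{(n)}$ are resampled from $\{v_{k}^{(m)}\}$ with weights $w_{k+1}^{(m)}$). The variables $\zeta_k^{(n)}$, $r_k^{(n)}$ are independent of each other and of the data. Given the data, $v_k$ is an inhomogeneous Markov chain on $\mathcal{X}^N$, and $q^k(z,\cdot)$ denotes the law of $v_k$ when $v_0=z$. *)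

(* Defs.v *)
From HB Require Import structures.
From mathcomp Require Import all_boot all_order all_algebra.
From mathcomp Require Import all_classical all_reals all_analysis.
From mathcomp Require Import measurable_realfun.

Set Implicit Arguments.
Unset Strict Implicit.
Unset Printing Implicit Defensive.
Import Order.TTheory GRing.Theory Num.Theory.
Import numFieldNormedType.Exports.
Local Open Scope classical_set_scope.
Local Open Scope ring_scope.

(* The Borel sigma-algebra of R^(m x n): it is generated by the coordinates. *)

Definition mx_display : measure_display -> measure_display.
Proof. exact. Qed.

Section measurable_matrix.
Context (R : realType) (m n : nat).

Definition mx_measurable : set (set 'M[R]_(m, n)) :=
  <<s \bigcup_(ij in [set: 'I_m * 'I_n])
        preimage_set_system setT (fun M : 'M[R]_(m, n) => M ij.1 ij.2)
          (@measurable _ R) >>.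

Let mx_set0 : mx_measurable set0.
Proof. exact: sigma_algebra0. Qed.

Let mx_setC A : mx_measurable A -> mx_measurable (~` A).
Proof. exact: sigma_algebraC. Qed.

Let mx_bigcup (F : (set 'M[R]_(m, n))^nat) :
  (forall i, mx_measurable (F i)) -> mx_measurable (\bigcup_i (F i)).
Proof. exact: sigma_algebra_bigcup. Qed.

HB.instance Definition _ := @isMeasurable.Build (mx_display default_measure_display)
  'M[R]_(m, n) mx_measurable mx_set0 mx_setC mx_bigcup.

End measurable_matrix.

Section measurable_matrix_lemmas.
Context d (T : measurableType d) (R : realType).

Lemma measurable_mx_coord m n (i : 'I_m) (j : 'I_n) :
  measurable_fun setT (fun M : 'M[R]_(m, n) => M i j).
Proof.
move=> _ A mA; apply: sub_sigma_algebra; exists (i, j) => //.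
by exists A.
Qed.

Lemma measurable_fun_mx m n (f : T -> 'M[R]_(m, n)) :
  (forall i j, measurable_fun setT (fun x => f x i j)) ->
  measurable_fun setT f.
Proof.
move=> mf; apply: (@measurability _ _ _ _ setT f
    (\bigcup_(ij in [set: 'I_m * 'I_n])
        preimage_set_system setT (fun M : 'M[R]_(m, n) => M ij.1 ij.2)
          (@measurable _ R))) => //.
move=> _ [B [[i j] _ [A mA <-]] <-] /=.
rewrite setTI; exact: mf.
Qed.

Lemma measurable_fun_coord m n (f : T -> 'M[R]_(m, n)) i j :
  measurable_fun setT f -> measurable_fun setT (fun x => f x i j).
Proof. by move=> mf; exact: (measurableT_comp (measurable_mx_coord i j) mf). Qed.

Lemma measurable_mulmx m n l (A : 'M[R]_(m, n)) (f : T -> 'M[R]_(n, l)) :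
  measurable_fun setT f -> measurable_fun setT (fun x => A *m f x).
Proof.
move=> mf; apply: measurable_fun_mx => i j.
under eq_fun do rewrite mxE.
apply: measurable_sum => k; apply: measurable_funM => //.
exact: measurable_fun_coord.
Qed.

Lemma measurable_addmx m n (f g : T -> 'M[R]_(m, n)) :
  measurable_fun setT f -> measurable_fun setT g ->
  measurable_fun setT (fun x => f x + g x).
Proof.
move=> mf mg; apply: measurable_fun_mx => i j.
under eq_fun do rewrite mxE.
by apply: measurable_funD; exact: measurable_fun_coord.
Qed.

Lemma measurable_oppmx m n (f : T -> 'M[R]_(m, n)) :
  measurable_fun setT f -> measurable_fun setT (fun x => - f x).
Proof.
move=> mf; apply: measurable_fun_mx => i j.
under eq_fun do rewrite mxE.
by apply: measurableT_comp => //; exact: measurable_fun_coord.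
Qed.

Lemma measurable_scalemx m n (a : T -> R) (f : T -> 'M[R]_(m, n)) :
  measurable_fun setT a -> measurable_fun setT f ->
  measurable_fun setT (fun x => a x *: f x).
Proof.
move=> ma mf; apply: measurable_fun_mx => i j.
under eq_fun do rewrite mxE.
by apply: measurable_funM => //; exact: measurable_fun_coord.
Qed.

Lemma measurable_summx m n (I : Type) (s : seq I) (f : I -> T -> 'M[R]_(m, n)) :
  (forall i, measurable_fun setT (f i)) ->
  measurable_fun setT (fun x => \sum_(i <- s) f i x).
Proof.
move=> mf; apply: measurable_fun_mx => i j.
under eq_fun do rewrite summxE.
by apply: measurable_sum => k; exact: measurable_fun_coord.
Qed.

End measurable_matrix_lemmas.

Section linear_algebra.
Context (R : realType).

Definition symmetricmx n (A : 'M[R]_n) : Prop := A^T = A.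

Definition posdefmx n (A : 'M[R]_n) : Prop :=
  symmetricmx A /\
  forall x : 'cV[R]_n, x != 0 -> 0 < (x^T *m A *m x) 0 0.

Definition possemidefmx n (A : 'M[R]_n) : Prop :=
  symmetricmx A /\
  forall x : 'cV[R]_n, 0 <= (x^T *m A *m x) 0 0.

(* The library norm `|x| on matrices is the maximum norm, not this one. *)
Definition enorm n (x : 'cV[R]_n) : R := Num.sqrt (\sum_(i < n) x i 0 ^+ 2).

(* A^(1/2): a positive definite A has exactly one positive definite square
   root; the default 0 is irrelevant for such A. *)
Definition sqrtmx n (A : 'M[R]_n) : 'M[R]_n :=
  xget 0 [set B | posdefmx B /\ B *m B = A].

Definition wnorm n (A : 'M[R]_n) (x : 'cV[R]_n) : R :=
  enorm (invmx (sqrtmx A) *m x).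

End linear_algebra.

Section probability.
Context (R : realType).

Definition std_gaussian_law n (mu : probability 'cV[R]_n R) : Prop :=
  forall A : 'I_n -> set R, (forall i, measurable (A i)) ->
    mu [set x : 'cV[R]_n | forall i, A i (x i 0)] =
    (\prod_(i < n) normal_prob 0 1 (A i))%E.

(* N(0, Sigma), Sigma possibly singular: the law of B Z, where B B^T = Sigma
   and Z is a vector of independent N(0, 1) variables. *)
Definition centered_gaussian_law n (Sigma : 'M[R]_n)
    (mu : probability 'cV[R]_n R) : Prop :=
  exists (B : 'M[R]_n) (nu : probability 'cV[R]_n R),
    [/\ B *m B^T = Sigma, std_gaussian_law nu &
        forall A, measurable A -> mu A = nu [set x | A (B *m x)]].

Definition uniform01_law (mu : probability R R) : Prop :=
  forall A, measurable A -> mu A = uniform_prob (@ltr01 R) A.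

Definition mutually_independent d (Omega : measurableType d)
    (P : probability Omega R) (I : eqType) (F : I -> set (set Omega)) : Prop :=
  forall (s : seq I) (E : I -> set Omega), uniq s ->
    (forall i, i \in s -> F i (E i)) ->
    P (\bigcap_(i in [set` s]) E i) = (\prod_(i <- s) P (E i))%E.

(* All the variables X i and Y j together are mutually independent: when the
   X i are i.i.d. and the Y j are i.i.d., this says that moreover the two
   families are independent of each other. *)
Definition jointly_independent d d1 d2 (Omega : measurableType d)
    (T1 : measurableType d1) (T2 : measurableType d2)
    (P : probability Omega R) (I J : eqType)
    (X : I -> {RV P >-> T1}) (Y : J -> {RV P >-> T2}) : Prop :=
  mutually_independent P (fun ij : I + J =>
    match ij with
    | inl i => g_sigma_algebra_preimage (X i)
    | inr j => g_sigma_algebra_preimage (Y j)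
    end).

Definition tv_dist d (T : measurableType d) (mu nu : probability T R) : R :=
  2^-1 * sup [set `|\int[mu]_z h z - \int[nu]_z h z| | h in
    [set h : T -> R | measurable_fun setT h /\ forall z, `|h z| <= 1]].

End probability.

Section model.
Context (R : realType) (d p : nat).
Implicit Types (psi : 'cV[R]_d -> 'cV[R]_d) (H : 'M[R]_(p, d)).
Implicit Types (Sigma : 'M[R]_d) (Gamma : 'M[R]_p).

Definition post_cov H Sigma Gamma : 'M[R]_d :=
  invmx (invmx Sigma + H^T *m invmx Gamma *m H).

Definition innov_cov H Sigma Gamma : 'M[R]_p := H *m Sigma *m H^T + Gamma.

Definition gain H Sigma Gamma : 'M[R]_(d, p) :=
  Sigma *m H^T *m invmx (innov_cov H Sigma Gamma).

Fixpoint signal psi (s : R) (u0 : 'cV[R]_d) (xi : nat -> 'cV[R]_d) (k : nat)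
    : 'cV[R]_d :=
  match k with
  | 0 => u0
  | k'.+1 => psi (signal psi s u0 xi k') + s *: xi k'
  end.

Definition observation psi H (r gamma : R) (u0 : 'cV[R]_d)
    (xi : nat -> 'cV[R]_d) (eta : nat -> 'cV[R]_p) (k : nat) : 'cV[R]_p :=
  H *m signal psi (r * gamma) u0 xi k + gamma *: eta k.

End model.

(* Particles are numbered from 0: index m below is m + 1 in the usual
   numbering of the particles 1, ..., N. *)
Section gaussianized_optimal_particle_filter.
Context (R : realType) (d p N : nat).
Context (psi : 'cV[R]_d -> 'cV[R]_d) (H : 'M[R]_(p, d)).
Context (Sigma : 'M[R]_d) (Gamma : 'M[R]_p).
Implicit Types (y : 'cV[R]_p) (v : N.-tuple 'cV[R]_d).

Let S := innov_cov H Sigma Gamma.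
Let K := gain H Sigma Gamma.

Definition weight_star y v (n : 'I_N) : R :=
  expR (- 2^-1 * wnorm S (y - H *m psi (tnth v n)) ^+ 2).

Definition weight y v (n : 'I_N) : R :=
  weight_star y v n / \sum_(m < N) weight_star y v m.

Definition alpha y v (m : nat) : R := \sum_(j < N | (j < m)%N) weight y v j.

Definition resample y v (r : R) : 'cV[R]_d :=
  \sum_(m < N) \1_(`[alpha y v m, alpha y v m.+1[%classic) r *: tnth v m.

Definition gopf_step y v (r : 'I_N -> R) (zeta : 'I_N -> 'cV[R]_d)
    : N.-tuple 'cV[R]_d :=
  [tuple (1%:M - K *m H) *m psi (resample y v (r n)) + K *m y + zeta n
    | n < N].

Fixpoint gopf (y : nat -> 'cV[R]_p) (z : N.-tuple 'cV[R]_d)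
    (r : nat -> 'I_N -> R) (zeta : nat -> 'I_N -> 'cV[R]_d) (k : nat)
    : N.-tuple 'cV[R]_d :=
  match k with
  | 0 => z
  | k'.+1 => gopf_step (y k'.+1) (gopf y z r zeta k') (r k'.+1) (zeta k')
  end.

End gaussianized_optimal_particle_filter.

Section gopf_measurable.
Context (R : realType) (d p N : nat).
Context (psi : {mfun 'cV[R]_d >-> 'cV[R]_d}) (H : 'M[R]_(p, d)).
Context (Sigma : 'M[R]_d) (Gamma : 'M[R]_p).
Context d0 (T : measurableType d0).
Implicit Types (y : 'cV[R]_p) (v : T -> N.-tuple 'cV[R]_d).

Lemma weight_star_gt0 y (v : N.-tuple 'cV[R]_d) n :
  0 < weight_star psi H Sigma Gamma y v n.
Proof. exact: expR_gt0. Qed.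

Lemma measurable_enorm_sqr n (f : T -> 'cV[R]_n) : measurable_fun setT f ->
  measurable_fun setT (fun t => enorm (f t) ^+ 2).
Proof.
move=> mf.
rewrite (_ : (fun _ => _) = fun t => \sum_(i < n) f t i 0 ^+ 2); last first.
  apply/funext => t; rewrite /enorm sqr_sqrtr //.
  by apply: sumr_ge0 => i _; exact: sqr_ge0.
apply: measurable_sum => i; apply: measurable_funX.
exact: measurable_fun_coord.
Qed.

Lemma measurable_psi_tnth v n : measurable_fun setT v ->
  measurable_fun setT (fun t => psi (tnth (v t) n)).
Proof.
move=> mv; apply: measurableT_comp => //.
by move/measurable_fun_tnthP : mv; apply.
Qed.

Lemma measurable_weight_star y v n : measurable_fun setT v ->
  measurable_fun setT (fun t => weight_star psi H Sigma Gamma y (v t) n).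
Proof.
move=> mv; rewrite /weight_star /wnorm.
apply: measurableT_comp => //; apply: measurable_funM => //.
apply: measurable_enorm_sqr; apply: measurable_mulmx.
apply: measurable_addmx => //; apply: measurable_oppmx.
by apply: measurable_mulmx; exact: measurable_psi_tnth.
Qed.

Lemma measurable_weight y v n : measurable_fun setT v ->
  measurable_fun setT (fun t => weight psi H Sigma Gamma y (v t) n).
Proof.
move=> mv; rewrite /weight; apply: measurable_funM.
  exact: measurable_weight_star.
rewrite (_ : (fun _ => _^-1) = fun t =>
    (\sum_(m < N) weight_star psi H Sigma Gamma y (v t) m) `^ (-1)); last first.
  apply/funext => t; rewrite powR_inv1 //.
  by apply: sumr_ge0 => m _; exact/ltW/weight_star_gt0.
apply: (measurableT_comp (measurable_powR _)) => //.
by apply: measurable_sum => m; exact: measurable_weight_star.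
Qed.

Lemma measurable_alpha y v m : measurable_fun setT v ->
  measurable_fun setT (fun t => alpha psi H Sigma Gamma y (v t) m).
Proof.
move=> mv; rewrite /alpha; under eq_fun do rewrite big_mkcond.
by apply: measurable_sum => j; case: (_ < _)%N => //; exact: measurable_weight.
Qed.

Lemma measurable_resample y v (r : T -> R) :
  measurable_fun setT v -> measurable_fun setT r ->
  measurable_fun setT (fun t => resample psi H Sigma Gamma y (v t) (r t)).
Proof.
move=> mv mr; apply: measurable_summx => m; apply: measurable_scalemx; last first.
  by move/measurable_fun_tnthP : mv; apply.
rewrite (_ : (fun _ => _) = fun t =>
    if (alpha psi H Sigma Gamma y (v t) m <= r t) &&
       (r t < alpha psi H Sigma Gamma y (v t) m.+1) then 1 else 0); last first.
  by apply/funext => t; rewrite indicE mem_setE in_itv /=; case: (_ && _).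
apply: measurable_fun_ifT => //; apply: measurable_and.
  by apply: measurable_fun_ler => //; exact: measurable_alpha.
by apply: measurable_fun_ltr => //; exact: measurable_alpha.
Qed.

Lemma measurable_gopf (y : nat -> 'cV[R]_p) z
    (r : nat -> 'I_N -> {mfun T >-> R})
    (zeta : nat -> 'I_N -> {mfun T >-> 'cV[R]_d}) k :
  measurable_fun setT (fun t => gopf psi H Sigma Gamma y z
    (fun j n => r j n t) (fun j n => zeta j n t) k).
Proof.
elim: k => [|k IH] //=.
apply/measurable_fun_tnthP => n; rewrite /comp.
under eq_fun do rewrite tnth_mktuple.
apply: measurable_addmx => //; apply: measurable_addmx => //.
apply: measurable_mulmx; apply: measurableT_comp => //.
exact: measurable_resample.
Qed.

End gopf_measurable.

Section gopf_law.
Context (R : realType) (d p N : nat).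
Context (psi : {mfun 'cV[R]_d >-> 'cV[R]_d}) (H : 'M[R]_(p, d)).
Context (Sigma : 'M[R]_d) (Gamma : 'M[R]_p).
Context d0 (Omega : measurableType d0) (P : probability Omega R).
Context (r : nat -> 'I_N -> {RV P >-> R}).
Context (zeta : nat -> 'I_N -> {RV P >-> 'cV[R]_d}).

Definition gopf_ensemble (y : nat -> 'cV[R]_p) (k : nat)
    (z : N.-tuple 'cV[R]_d) (w : Omega) : N.-tuple 'cV[R]_d :=
  gopf psi H Sigma Gamma y z (fun j n => r j n w) (fun j n => zeta j n w) k.

HB.instance Definition _ y k z :=
  isMeasurableFun.Build _ _ _ _ (gopf_ensemble y k z)
    (measurable_gopf psi H Sigma Gamma y z r zeta k).

(* q^k(z, .) for fixed data y: the filter is driven by a probability space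
   (Omega, P) of its own, hence independently of the data. *)
Definition gopf_law (y : nat -> 'cV[R]_p) (k : nat) (z : N.-tuple 'cV[R]_d)
    : probability (N.-tuple 'cV[R]_d) R :=
  distribution P (gopf_ensemble y k z).

End gopf_law.

(* Main.v *)
Require Import Defs.
From HB Require Import structures.
From mathcomp Require Import all_boot all_order all_algebra.
From mathcomp Require Import all_classical all_reals all_analysis.
From mathcomp Require Import measurable_realfun.
From mathcomp Require Import lra.
Set Implicit Arguments.
Unset Strict Implicit.
Unset Printing Implicit Defensive.
Import Order.TTheory GRing.Theory Num.Theory.
Import numFieldNormedType.Exports.
Local Open Scope classical_set_scope.
Local Open Scope ring_scope.

(** The ensemble is a time-inhomogeneous Markov chain that satisfies Doeblin's
    condition with a constant that depends neither on time nor on the data, so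
    the bound holds for every realization of the data, and no ergodic property
    of the data is needed.

    One step moves particle [n] to [m n + K y + zeta n], where
    [m n = (1 - K H) psi (resampled particle)]. The observation [y] enters the
    mean only through the common shift [K y], which is the same for both
    ensembles; it also enters through the resampling weights, but whatever vector
    is resampled, [m n] stays in a fixed bounded set because [psi] is bounded.

    On a bounded set of means, Gaussian laws with a common invertible
    covariance are all bounded below by a multiple [c] of one probability. On
    the line this compares the density of N(a, 1), for [a] bounded, with the
    uniform law on [0, 1] ([shifted_normal_minorized]). The comparison passes to
    products ([tuple_minorized]), hence to standard Gaussian vectors, to their
    linear images ([gaussian_minorized]), and to the ensemble given the
    resampling ([ensemble_minorized]).

    A minorization by [e] times a probability makes the average of any function
    with values in [0, 1] vary by at most [1 - e] over the starting points
    ([minorized_integral]). Since the noise of a step is independent of the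
    past, iterating this gives a contraction by [(1 - e) ^ k] after [k] steps
    ([doeblin_contraction]), that is, a total variation distance at most
    [(1 - e) ^ k] ([gopf_tv_bound]); its [k]-th root is at most [1 - e]. *)

(** * Probabilities on tuples *)

(** Image measures, packaged as an existence statement so that the map need not
    be registered as a measurable function. *)
Lemma image_probability (R : realType) (d1 d2 : measure_display)
  (T1 : measurableType d1) (T2 : measurableType d2) (P : probability T1 R)
  (f : T1 -> T2) : measurable_fun setT f ->
  exists Q : probability T2 R,
    (forall A, Q A = P (f @^-1` A)) /\
    (forall h : T2 -> \bar R, measurable_fun [set: T2] h -> (forall x, 0 <= h x)%E ->
      (\int[Q]_x h x = \int[P]_w h (f w))%E).
Proof.
move=> mf.
pose X : {RV P >-> T2} := HB.pack f (isMeasurableFun.Build _ _ _ _ _ mf).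
exists (distribution P X); split=> // h mh h0.
exact: ge0_integral_distribution.
Qed.

(** The product set of the [A i], inside the space of [n]-tuples. *)
Definition rectangle d (T : measurableType d) n (A : 'I_n -> set T) :
    set (n.-tuple T) :=
  [set t | forall i, A i (tnth t i)].

Lemma measurable_rectangle d (T : measurableType d) n (A : 'I_n -> set T) :
  (forall i, measurable (A i)) -> measurable (rectangle A).
Proof.
move=> mA.
rewrite (_ : rectangle A = \bigcap_(i in [set: 'I_n]) ((@tnth n T ^~ i) @^-1` A i)).
  apply: fin_bigcap_measurable => // i _; rewrite -[X in measurable X]setTI.
  exact: measurable_tnth.
by apply/seteqP; split=> t h i /=; [move=> _|]; exact: h.
Qed.

Lemma bigsetU_sub (T : Type) (I : finType) (F : I -> set T) (S : set T) :
  (forall i, F i `<=` S) -> \big[setU/set0]_i F i `<=` S.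
Proof.
by move=> FS; elim/big_ind : _ => // X Y XS YS; rewrite subUset.
Qed.

Lemma tuple_measurable_rectangle d (T : measurableType d) n (A : set (n.-tuple T)) :
  measurable A ->
  <<s [set X | exists2 B : 'I_n -> set T, (forall i, measurable (B i)) &
               X = rectangle B] >> A.
Proof.
move: A; apply: smallest_sub.
  exact: smallest_sigma_algebra.
apply: bigsetU_sub => i _ [B mB <-]; apply: sub_sigma_algebra => /=.
exists (fun j => if j == i then B else setT).
  by move=> j; case: ifP.
apply/seteqP; split=> t /=.
  by move=> [_ Bt] j /=; case: ifP => // /eqP ->.
by move=> /(_ i); rewrite eqxx.
Qed.

Lemma tuple_measure_unique d (T : measurableType d) (R : realType) n
  (m1 m2 : {measure set (n.-tuple T) -> \bar R}) :
  (m1 setT < +oo)%E ->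
  (forall B : 'I_n -> set T, (forall i, measurable (B i)) ->
    m1 (rectangle B) = m2 (rectangle B)) ->
  forall A, measurable A -> m1 A = m2 A.
Proof.
move=> m1oo m12 A mA.
apply: (g_sigma_algebra_measure_unique
  [set X | exists2 B : 'I_n -> set T, (forall i, measurable (B i)) &
               X = rectangle B] _ (fun=> setT)).
- by move=> _ [B mB ->]; exact: measurable_rectangle.
- move=> _; exists (fun=> setT) => //.
  by apply/seteqP.
- by rewrite bigcup_const.
- move=> _ _ [B mB ->] [C mC ->]; exists (fun i => B i `&` C i).
    by move=> i; exact: measurableI.
  apply/seteqP; split=> t /=; first by move=> [Bt Ct] i; split.
  by move=> BC; split=> i; have [] := BC i.
- by move=> _ [B mB ->]; exact: m12.
- by move=> _.
- exact: tuple_measurable_rectangle.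
Qed.

Lemma tuple_cons_measurable d (T : measurableType d) n :
  measurable_fun [set: T * n.-tuple T]
    (fun x => [the n.+1.-tuple T of x.1 :: x.2]).
Proof. exact: measurable_cons. Qed.

Lemma le_integral_scale (R : realType) (d : measure_display)
  (T : measurableType d) (m1 m2 : {measure set T -> \bar R}) (c : R)
  (f : T -> \bar R) : 0 <= c ->
  (forall A, measurable A -> (c%:E * m1 A <= m2 A)%E) ->
  measurable_fun setT f -> (forall x, 0 <= f x)%E ->
  (c%:E * \int[m1]_x f x <= \int[m2]_x f x)%E.
Proof.
move=> c0 m12 mf f0; pose cn : {nonneg R} := NngNum c0.
rewrite -[c%:E]/(cn%:num%:E) -ge0_integral_mscale //.
exact: ge0_le_measure_integral.
Qed.

(** If each [mu i] dominates [c] times [lam i], then a law whose coordinates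
    are independent with laws [mu i] dominates [c ^ n] times a probability [L]
    that does not depend on the [mu i]. The inequality is immediate on
    rectangles, but uniqueness of measures on a pi-system only transfers
    equalities to all measurable sets; the induction splits off one coordinate
    and compares iterated integrals instead. *)
Lemma tuple_minorized (R : realType) (d : measure_display) (T : measurableType d)
  (n : nat) (lam : 'I_n -> probability T R) (c : R) : 0 <= c ->
  exists L : probability (n.-tuple T) R,
  forall (mu : 'I_n -> probability T R) (rho : probability (n.-tuple T) R),
  (forall i A, measurable A -> (c%:E * lam i A <= mu i A)%E) ->
  (forall A, (forall i, measurable (A i)) ->
    rho (rectangle A) = (\prod_(i < n) mu i (A i))%E) ->
  forall A, measurable A -> ((c ^+ n)%:E * L A <= rho A)%E.
Proof.
move=> c0; elim: n lam => [|n IHn] lam.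
  exists (dirac [tuple]) => mu rho _ _ A mA.
  rewrite expr0 mul1e /= /dirac indicE.
  case: (boolP (_ \in A)) => [/set_mem An|_] /=; last exact: measure_ge0.
  rewrite (_ : A = setT) ?probability_setT //.
  by apply/seteqP; split=> // t _; rewrite tuple0.
have [L' HL'] := IHn (fun i => lam (lift ord0 i)).
have [L [LE _]] := image_probability (lam ord0 \x L')%E (@tuple_cons_measurable d T n).
exists L => mu rho cmu rhobox A mA.
have mtl : measurable_fun [set: n.+1.-tuple T]
  (fun x => [tuple of behead x] : n.-tuple T) by exact: measurable_behead.
have [rho' [rho'E _]] := image_probability rho mtl.
(* [rho'] is the law of the last [n] coordinates and [rho2] the product of
   [mu ord0] with [rho'] *)
have [rho2 [rho2E _]] :=
  image_probability (mu ord0 \x rho')%E (@tuple_cons_measurable d T n).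
have rho'rectangle B : (forall i, measurable (B i)) ->
    rho' (rectangle B) = (\prod_(i < n) mu (lift ord0 i) (B i))%E.
  move=> mB; rewrite rho'E.
  pose B' (i : 'I_n.+1) := if unlift ord0 i is Some j then B j else setT.
  have B'0 : B' ord0 = setT by rewrite /B' unlift_none.
  have B'S j : B' (lift ord0 j) = B j by rewrite /B' liftK.
  have := rhobox B'; rewrite big_ord_recl B'0 probability_setT mul1e.
  under eq_bigr do rewrite B'S.
  move=> <-; last first.
    by move=> i; rewrite /B'; case: unlift.
  congr (rho _); apply/seteqP; split=> t /=.
    move=> Bt i; rewrite /B'; case: unliftP => [j ->|//].
    by rewrite (tuple_eta t) tnthS; exact: Bt.
  by move=> Bt i; have := Bt (lift ord0 i); rewrite B'S {1}(tuple_eta t) tnthS.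
have -> : rho A = rho2 A.
  apply: tuple_measure_unique => //.
    by rewrite [X in (X < _)%E](probability_setT rho) ltry.
  move=> B mB; suff : rho (rectangle B) = rho2 (rectangle B) by [].
  rewrite rhobox // rho2E big_ord_recl -rho'rectangle //.
  rewrite -product_measure1E //; last exact: measurable_rectangle.
  congr ((_ \x _)%E _); apply/seteqP; split=> -[x t] /=.
    move=> [Bx Bt] i; case: (unliftP ord0 i) => [j ->|->] //=.
    by rewrite tnthS; exact: Bt.
  move=> Bxt; split; first exact: (Bxt ord0).
  by move=> i; have := Bxt (lift ord0 i); rewrite tnthS.
rewrite LE rho2E.
set A' := _ @^-1` A.
have mA' : measurable A'.
  by rewrite -[A']setTI; exact: tuple_cons_measurable.
rewrite /=/product_measure1.
pose f x := L' (xsection A' x).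
have mf : measurable_fun setT f by exact: measurable_fun_xsection.
apply: (@le_trans _ _ (\int[mu ord0]_x ((c ^+ n)%:E * f x))%E); last first.
  apply: ge0_le_integral => //.
  - by move=> x _; rewrite mule_ge0 // lee_fin exprn_ge0.
  - by apply: measurable_funeM.
  - exact: measurable_fun_xsection.
  - move=> x _; apply: (HL' (fun i => mu (lift ord0 i))) => //.
      by move=> i B mB; exact: cmu.
    exact: measurable_xsection.
rewrite ge0_integralZl //; last by rewrite lee_fin exprn_ge0.
rewrite exprSr EFinM -muleA; apply: lee_wpmul2l; first by rewrite lee_fin exprn_ge0.
apply: le_integral_scale => // B mB; exact: cmu.
Qed.

Lemma unit_integrable (R : realType) (d : measure_display) (T : measurableType d)
  (Q : probability T R) (h : T -> R) : measurable_fun setT h ->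
  (forall x, 0 <= h x <= 1) -> Q.-integrable setT (EFin \o h).
Proof.
move=> mh h01.
apply: (le_integrable _ _ _ (finite_measure_integrable_cst Q 1 measurableT)) => //.
- exact/measurable_EFinP.
- move=> x _ /=; have /andP[h0 h1] := h01 x.
  by rewrite lee_fin normr1 ger0_norm.
Qed.

Lemma unit_integral_EFin (R : realType) (d : measure_display) (T : measurableType d)
  (Q : probability T R) (h : T -> R) : measurable_fun setT h ->
  (forall x, 0 <= h x <= 1) ->
  (\int[Q]_x (h x)%:E)%E = (\int[Q]_x h x)%:E.
Proof.
move=> mh h01; rewrite /Rintegral fineK //.
by apply: integrable_fin_num => //; exact: unit_integrable.
Qed.

(** The upper bound is the lower bound for [1 - h]. *)
Lemma minorized_integral (R : realType) (d : measure_display) (T : measurableType d)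
  (Q L : probability T R) (e : R) (h : T -> R) : 0 <= e ->
  (forall A, measurable A -> (e%:E * L A <= Q A)%E) ->
  measurable_fun setT h -> (forall x, 0 <= h x <= 1) ->
  e * \int[L]_x h x <= \int[Q]_x h x <= e * \int[L]_x h x + (1 - e).
Proof.
move=> e0 LQ mh h01.
have low (g : T -> R) : measurable_fun setT g -> (forall x, 0 <= g x <= 1) ->
    e * \int[L]_x g x <= \int[Q]_x g x.
  move=> mg g01; rewrite -lee_fin EFinM -!unit_integral_EFin //.
  apply: le_integral_scale => //; first exact/measurable_EFinP.
  by move=> x; rewrite lee_fin; case/andP: (g01 x).
have compl (P : probability T R) : \int[P]_x (1 - h x) = 1 - \int[P]_x h x.
  rewrite RintegralB //; last exact: unit_integrable.
    by rewrite Rintegral_cst // mul1r [X in fine X](probability_setT P).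
  exact: finite_measure_integrable_cst.
apply/andP; split; first exact: low.
have : e * \int[L]_x (1 - h x) <= \int[Q]_x (1 - h x).
  apply: low => [|x]; first exact: measurable_funB.
  by have /andP[h0 h1] := h01 x; rewrite subr_ge0 h1 lerBlDr lerDl h0.
rewrite !compl; lra.
Qed.

(** * Independence *)

(** Independence of a fixed event extends from a pi-system to the
    sigma-algebra that it generates. *)
Lemma indep_generated (R : realType) (d : measure_display)
  (Omega : measurableType d) (P : probability Omega R)
  (G : set (set Omega)) (E : set Omega) :
  G `<=` measurable -> G setT -> setI_closed G -> measurable E ->
  (forall D, G D -> P (D `&` E) = (P D * P E)%E) ->
  forall D, <<s G >> D -> P (D `&` E) = (P D * P E)%E.
Proof.
move=> Gm GT GI mE GE D sGD.
have PE0 : 0 <= fine (P E) by exact/fine_ge0/measure_ge0.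
have PEfin : P E \is a fin_num by exact: fin_num_measure.
pose k : {nonneg R} := NngNum PE0.
have kE A : mscale k P A = (P A * P E)%E by rewrite /mscale /= fineK // muleC.
have : mrestr P mE D = mscale k P D.
  apply: (g_sigma_algebra_measure_unique G Gm (fun=> setT)) => //.
  - by rewrite bigcup_const.
  - by move=> A GA; rewrite [RHS]kE; exact: GE.
  - move=> _; apply: (le_lt_trans _ (ltry 1)); apply: probability_le1.
    exact: measurableI.
by rewrite kE.
Qed.

(** Intersections of events of the families [F i], one for each [i] in the list
    [s]. When every [F i] contains the whole space and is stable under
    intersection, these form a pi-system containing all the [F i] with [i] in
    [s]. *)
Definition cylinders (T : Type) (I : eqType) (F : I -> set (set T)) (s : seq I)
    : set (set T) :=
  [set X | exists2 E : I -> set T,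
     (forall i, F i (E i)) & X = \bigcap_(i in [set` s]) E i].

Section independent_families.
Context (R : realType) (d : measure_display) (Omega : measurableType d)
  (P : probability Omega R) (I : eqType) (F : I -> set (set Omega)).
Hypothesis Fm : forall i, F i `<=` measurable.
Hypothesis FT : forall i, F i setT.
Hypothesis FI : forall i, setI_closed (F i).

Lemma cylinders_measurable s : cylinders F s `<=` measurable.
Proof.
move=> _ [E FE ->]; apply: fin_bigcap_measurable => [|i _]; last exact: Fm.
exact: finite_seq.
Qed.

Lemma cylinders_setT s : cylinders F s setT.
Proof.
by exists (fun=> setT) => //; apply/seteqP; split.
Qed.

Lemma cylinders_setI s : setI_closed (cylinders F s).
Proof.
move=> _ _ [D FD ->] [E FE ->]; exists (fun i => D i `&` E i).
  by move=> i; exact: FI.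
by rewrite bigcapI.
Qed.

Lemma sub_cylinders s i : i \in s -> F i `<=` cylinders F s.
Proof.
move=> si A FA; exists (fun j => if j == i then A else setT).
  by move=> j; case: eqP => [->|].
apply/seteqP; split=> w /=.
  by move=> Aw j _; case: ifP.
by move=> /(_ i si); rewrite eqxx.
Qed.

Lemma independent_cat s t : mutually_independent P F -> uniq (s ++ t) ->
  forall D E, <<s cylinders F s >> D -> <<s cylinders F t >> E ->
  P (D `&` E) = (P D * P E)%E.
Proof.
move=> indF; rewrite cat_uniq => /and3P[us /hasPn st ut] D E sD tE.
have mE : measurable E.
  move: tE; apply: smallest_sub; first exact: sigma_algebra_measurable.
  exact: cylinders_measurable.
have mGs := @cylinders_measurable s.
have GsT := @cylinders_setT s.
have GsI := @cylinders_setI s.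
have mGt := @cylinders_measurable t.
have GtT := @cylinders_setT t.
have GtI := @cylinders_setI t.
apply: (indep_generated mGs GsT GsI mE _ sD) => D1 sD1.
rewrite setIC muleC.
apply: (indep_generated mGt GtT GtI (mGs _ sD1) _ tE) => E1 tE1.
case: sD1 => D' FD' ->; case: tE1 => E' FE' ->.
(* the two cylinders are cylinders of one common choice of events, since [s]
   and [t] are disjoint *)
pose G i := if i \in s then D' i else E' i.
have FG i : F i (G i) by rewrite /G; case: ifP.
have DG : \bigcap_(i in [set` s]) D' i = \bigcap_(i in [set` s]) G i.
  by apply: eq_bigcapr => i /= si; rewrite /G si.
have EG : \bigcap_(i in [set` t]) E' i = \bigcap_(i in [set` t]) G i.
  by apply: eq_bigcapr => i /= ti; rewrite /G (negbTE (st _ ti)).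
rewrite DG EG.
have -> : \bigcap_(i in [set` t]) G i `&` \bigcap_(i in [set` s]) G i =
    \bigcap_(i in [set` s ++ t]) G i.
  apply/seteqP; split=> w /=.
    by move=> [tw sw] i /=; rewrite mem_cat => /orP[/sw|/tw].
  by move=> stw; split=> i /= ?; apply: stw; rewrite /= mem_cat; apply/orP; [right|left].
rewrite !indF //; last by rewrite cat_uniq us ut andbT; apply/hasPn.
by rewrite big_cat muleC.
Qed.

Lemma cylinders_undup s : cylinders F (undup s) = cylinders F s.
Proof.
rewrite /cylinders (_ : [set` undup s] = [set` s]) //.
by apply/seteqP; split=> i /=; rewrite mem_undup.
Qed.

(** Measurability of [X] with respect to the events indexed by [s] is expressed
    by giving its domain the sigma-algebra generated by the cylinders. *)
Lemma independent_functions s t (d1 d2 : measure_display)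
  (T1 : measurableType d1) (T2 : measurableType d2)
  (X : g_sigma_algebraType (cylinders F s) -> T1)
  (Y : g_sigma_algebraType (cylinders F t) -> T2) :
  mutually_independent P F -> (forall i, i \in s -> i \notin t) ->
  measurable_fun setT X -> measurable_fun setT Y ->
  forall A B, measurable A -> measurable B ->
  P (X @^-1` A `&` Y @^-1` B) = (P (X @^-1` A) * P (Y @^-1` B))%E.
Proof.
move=> indF st mX mY A B mA mB.
apply: (@independent_cat (undup s) (undup t)) => //.
- rewrite cat_uniq !undup_uniq andbT /=; apply/hasPn => i.
  by rewrite !mem_undup => it; apply: contraL it; exact: st.
- by have := mX measurableT _ mA; rewrite setTI cylinders_undup.
- by have := mY measurableT _ mB; rewrite setTI cylinders_undup.
Qed.

End independent_families.

Lemma measurable_cylinders_coord (d d1 : measure_display)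
  (Omega : measurableType d) (T1 : measurableType d1) (I : eqType)
  (F : I -> set (set Omega)) (s : seq I) (i : I) (X : Omega -> T1) :
  (forall i, F i setT) -> i \in s -> F i = g_sigma_algebra_preimage X ->
  measurable_fun [set: g_sigma_algebraType (cylinders F s)]
    (X : g_sigma_algebraType (cylinders F s) -> T1).
Proof.
move=> FT si FiX _ A mA; apply: sub_sigma_algebra.
by apply: (sub_cylinders FT si); rewrite FiX; exists A.
Qed.

Section independent_variables.
Local Open Scope ereal_scope.
Context (R : realType) (d d1 d2 : measure_display) (Omega : measurableType d)
  (T1 : measurableType d1) (T2 : measurableType d2) (P : probability Omega R).

Lemma independent_integral (X : Omega -> T1) (Y : Omega -> T2)
  (h : T1 * T2 -> \bar R) :
  measurable_fun setT X -> measurable_fun setT Y ->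
  (forall A B, measurable A -> measurable B ->
    P (X @^-1` A `&` Y @^-1` B) = P (X @^-1` A) * P (Y @^-1` B)) ->
  measurable_fun setT h -> (forall x, 0 <= h x) ->
  \int[P]_w h (X w, Y w) = \int[P]_w \int[P]_w' h (X w, Y w').
Proof.
move=> mX mY indXY mh h0.
have mXY : measurable_fun setT (fun w => (X w, Y w)) by exact: measurable_fun_pair.
have [Q [QE Qint]] := image_probability P mXY.
have [QX [QXE QXint]] := image_probability P mX.
have [QY [QYE QYint]] := image_probability P mY.
rewrite -Qint // (eq_measure_integral (QX \x QY)); last first.
  move=> A mA _; apply/esym/product_measure_unique => // A1 B mA1 mB.
  suff : Q (A1 `*` B) = QX A1 * QY B by [].
  by rewrite QE QXE QYE -indXY.
rewrite fubini_tonelli1 // QXint //; last 2 first.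
  exact: measurable_fun_fubini_tonelli_F.
  by move=> x; exact: integral_ge0.
apply: eq_integral => w _; rewrite /fubini_F QYint //.
exact: measurable_fun_pair2.
Qed.

End independent_variables.

(** * Minorization of Gaussian laws *)

Section gaussian_line.
Context (R : realType).
Let mu := @lebesgue_measure R.

Lemma lebesgue_measure_shift (a : R) (A : set (measurableTypeR R)) : measurable A ->
  mu ((fun x => a + x) @^-1` A) = mu A.
Proof.
move=> mA.
have mshift : measurable_fun [set: measurableTypeR R]
    (fun x => a + x : measurableTypeR R) by exact: measurable_funD.
pose f : {mfun measurableTypeR R >-> measurableTypeR R} :=
  HB.pack (fun x : measurableTypeR R => a + x : measurableTypeR R)
    (isMeasurableFun.Build _ _ _ _ _ mshift).
rewrite -[LHS]/(pushforward mu f A).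
apply/esym; apply: lebesgue_measure_unique => // _ [[x y] /= xy <-].
rewrite /pushforward (_ : _ @^-1` _ = `]x - a, y - a]%classic); last first.
  by apply/seteqP; split=> z /=; rewrite !in_itv /= ltrBlDl lerBrDl.
rewrite !lebesgue_measure_itv /= !lte_fin ltrD2r -!EFinB.
by congr (if _ then _%:E else _); lra.
Qed.

(** The law of [a + Z], with [Z] standard normal, dominates [c] times the uniform
    law on [0, 1], with one [c] for all [a] bounded by [L]. *)
Lemma shifted_normal_minorized (L : R) :
  exists2 c : R, 0 < c < 1 & forall (a : R) (A : set R),
  `|a| <= L -> measurable A ->
  (c%:E * uniform_prob (@ltr01 R) A <=
   normal_prob (0 : R) 1 ((fun x : R => (a + x)%R) @^-1` A))%E.
Proof.
(* [m0] is the value at distance [L + 1] from the mean of the N(0, 1) density: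
   if [0 <= a + x <= 1] and [`|a| <= L], then [`|x| <= L + 1] *)
pose m0 := normal_peak (1 : R) * expR (- (L + 1) ^+ 2 / (1 ^+ 2 *+ 2)).
have m0gt0 : 0 < m0 by rewrite mulr_gt0 ?expR_gt0 // normal_peak_gt0 // oner_neq0.
exists (Num.min m0 2^-1).
  by rewrite lt_min m0gt0 invr_gt0 ltr0n /= gt_min; apply/orP; right; lra.
set c := Num.min _ _ => a A aL mA.
have cge0 : 0 <= c by rewrite le_min (ltW m0gt0) invr_ge0 ler0n.
pose B := A `&` `[0, 1]%classic.
have mB : measurable B by exact: measurableI.
have msh (D : set R) : measurable D -> measurable ((fun x : R => a + x) @^-1` D).
  move=> mD; rewrite -[X in measurable X]setTI.
  by apply: measurable_funD => //; exact: measurable_cst.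
have -> : uniform_prob (@ltr01 R) A = mu B.
  rewrite /uniform_prob integral_uniform_pdf.
  rewrite (eq_integral (fun=> 1%E)) ?integral_cst ?mul1e //.
  move=> x /set_mem [_ /=]; rewrite in_itv /= /uniform_pdf => ->.
  by rewrite subr0 invr1.
have step1 : (c%:E * mu B <= \int[mu]_(x in (fun x : R => (a + x)%R) @^-1` B) c%:E)%E.
  rewrite integral_cst; last exact: msh.
  apply: lee_wpmul2l; first by rewrite lee_fin.
  by rewrite le_eqVlt; apply/orP; left; apply/eqP/esym/lebesgue_measure_shift.
apply: (le_trans step1).
have step2 : (\int[mu]_(x in (fun x : R => (a + x)%R) @^-1` B) c%:E <=
    \int[mu]_(x in (fun x : R => (a + x)%R) @^-1` B) (normal_pdf 0 1 x)%:E)%E.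
  apply: ge0_le_integral => //.
  - exact: msh.
  - by apply/measurable_EFinP/measurable_funTS; exact: measurable_normal_pdf.
  - move=> x [_ /=]; rewrite in_itv /= => /andP[ax0 ax1].
    rewrite lee_fin normal_pdfE ?oner_neq0 // ge_min; apply/orP; left.
    rewrite ler_wpM2l ?normal_peak_ge0 // /normal_fun ler_expR.
    rewrite ler_wpM2r ?invr_ge0 // lerN2 subr0.
    move: aL; rewrite ler_norml => /andP[aL1 aL2].
    by rewrite -[leLHS]real_normK ?num_real // lerXn2r ?nnegrE //; [lra|];
       rewrite ler_norml; apply/andP; split; lra.
apply: (le_trans step2).
apply: ge0_subset_integral => //; try exact: msh.
- by apply/measurable_EFinP/measurable_funTS; exact: measurable_normal_pdf.
- by move=> x _; rewrite lee_fin normal_pdf_ge0.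
- by move=> x [].
Qed.
End gaussian_line.

Section gaussian_space.
Context (R : realType) (d : nat).

Lemma std_gaussian_minorized (L : R) :
  exists2 c : R, 0 < c <= 1 & exists Lam : probability 'cV[R]_d R,
  forall nu : probability 'cV[R]_d R, std_gaussian_law nu ->
  forall a : 'cV[R]_d, (forall i, `|a i 0| <= L) ->
  forall A, measurable A -> (c%:E * Lam A <= nu [set x | A (a + x)%R])%E.
Proof.
have [c1 /andP[c1gt0 c1lt1] Hc1] := shifted_normal_minorized L.
exists (c1 ^+ d); first by rewrite exprn_gt0 //= exprn_ile1 // ltW.
(* the uniform law, on the line equipped with its canonical Borel structure *)
have [U UE] : exists U : probability R R, forall A, U A = uniform_prob (@ltr01 R) A.
  have mid : measurable_fun [set: measurableTypeR R] (fun x => x : R).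
    exact: measurable_id.
  have [U [UE _]] := image_probability (uniform_prob (@ltr01 R)) mid.
  by exists U.
have [Lt HLt] := tuple_minorized (fun _ : 'I_d => U) (ltW c1gt0).
pose tuple_to_col (t : d.-tuple R) : 'cV[R]_d := \col_i tnth t i.
have mtoc : measurable_fun setT tuple_to_col.
  apply: measurable_fun_mx => i j; under eq_fun do rewrite mxE.
  exact: measurable_tnth.
have [Lam [LamE _]] := image_probability Lt mtoc.
exists Lam => nu nuG a aL A mA.
pose col_to_tuple (x : 'cV[R]_d) : d.-tuple R := [tuple (a + x) i 0 | i < d].
have mofc : measurable_fun setT col_to_tuple.
  apply/measurable_fun_tnthP => i; rewrite /comp.
  under eq_fun do rewrite tnth_mktuple.
  by apply: measurable_fun_coord; exact: measurable_addmx.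
have [rho [rhoE _]] := image_probability nu mofc.
have mshift (i : 'I_d) : measurable_fun setT (fun x : R => a i 0 + x).
  exact: measurable_funD.
have [mu muE] : exists mu : 'I_d -> probability R R, forall i B,
    mu i B = normal_prob 0 1 ((fun x : R => a i 0 + x) @^-1` B).
  have /choice[mu Hmu] : forall i : 'I_d, exists mu : probability R R, forall B,
      mu B = normal_prob 0 1 ((fun x : R => a i 0 + x) @^-1` B).
    move=> i; have [mu [muE _]] := image_probability (normal_prob 0 1) (mshift i).
    by exists mu.
  by exists mu.
have mtocA : measurable (tuple_to_col @^-1` A).
  by rewrite -[X in measurable X]setTI; exact: mtoc.
have := HLt mu rho _ _ _ mtocA.
rewrite LamE rhoE => /(_ _ _)H.
rewrite (_ : [set x | A (a + x)] = col_to_tuple @^-1` (tuple_to_col @^-1` A)); last first.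
  apply/seteqP; split => x /=; rewrite (_ : tuple_to_col (col_to_tuple x) = a + x) //;
    by apply/colP => i; rewrite mxE tnth_mktuple.
apply: H.
  by move=> i B mB; rewrite muE UE; exact: Hc1.
move=> B mB; rewrite rhoE.
pose B' (i : 'I_d) : set R := (fun x : R => a i 0 + x) @^-1` B i.
have mB' i : measurable (B' i).
  by rewrite -[X in measurable X]setTI; exact: mshift.
have := nuG B' mB'; under eq_bigr do rewrite -muE.
move=> <-; congr (nu _).
by apply/seteqP; split => x /= H i; move: (H i); rewrite tnth_mktuple mxE.
Qed.

(** The factor [B] with [B *m B^T = invmx Q] is part of the law and may change
    from one law to another, so the dominated probability depends on the law;
    the constant does not, because [B^-1 m] has squared norm [m^T Q m], which is
    bounded in terms of [Q] and [L] only. *)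
Lemma gaussian_minorized (Q : 'M[R]_d) (L : R) : Q \in unitmx ->
  exists2 c : R, 0 < c <= 1 &
  forall mu : probability 'cV[R]_d R, centered_gaussian_law (invmx Q) mu ->
  exists Lam : probability 'cV[R]_d R,
  forall m : 'cV[R]_d, (forall i, `|m i 0| <= L) ->
  forall A, measurable A -> (c%:E * Lam A <= mu [set x | A (m + x)%R])%E.
Proof.
move=> uQ.
pose K := \sum_i \sum_j L * `|Q j i| * L.
(* [K] bounds [m^T Q m], and [K + 1] bounds its square root *)
have [c c01 [Lam0 HLam0]] := std_gaussian_minorized (K + 1).
exists c => // mu [B [nu [BBt nuG muE]]].
have BQB : B^T *m Q *m B = 1%:M.
  by apply: mulmx1C; rewrite mulmxA BBt mulVmx.
have mB : measurable_fun setT (fun x : 'cV[R]_d => B *m x) by exact: measurable_mulmx.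
have [Lam [LamE _]] := image_probability Lam0 mB.
exists Lam => m mL A mA.
have mA1 : measurable [set x | A (m + x)].
  rewrite -[X in measurable X]setTI.
  by apply: (@measurable_addmx _ _ _ _ _ (fun=> m) id).
rewrite muE // LamE.
have [u mE] : exists u, B *m u = m.
  by exists (B^T *m Q *m m); rewrite !mulmxA BBt mulVmx // mul1mx.
rewrite (_ : [set x | _] = [set x | (fun x => A (B *m x)) (u + x)]); last first.
  by apply/seteqP; split=> x /=; rewrite mulmxDr mE.
have uu : u^T *m u = m^T *m Q *m m.
  transitivity (u^T *m (B^T *m Q *m B) *m u); first by rewrite BQB mulmx1.
  by rewrite -[in RHS]mE trmx_mul !mulmxA.
apply: HLam0 => //.
  move=> i.
  have K0 : 0 <= K.
    apply: sumr_ge0 => j _; apply: sumr_ge0 => l _.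
    by rewrite !mulr_ge0 // (le_trans _ (mL j)).
  have le1 : u i 0 ^+ 2 <= (u^T *m u) 0 0.
    rewrite mxE (bigD1 i) //= mxE -expr2 lerDl; apply: sumr_ge0 => j _.
    by rewrite mxE -expr2 sqr_ge0.
  have le2 : (m^T *m Q *m m) 0 0 <= K.
    rewrite mxE; apply: ler_sum => j _; rewrite mxE mulr_suml; apply: ler_sum => l _.
    rewrite mxE; apply: le_trans (ler_norm _) _; rewrite !normrM.
    by rewrite !ler_pM // ?mulr_ge0.
  rewrite -sqrtr_sqr; apply: (@le_trans _ _ (Num.sqrt ((K + 1) ^+ 2))).
    by rewrite ler_wsqrtr //; move: le1 le2; rewrite uu; nra.
  by rewrite sqrtr_sqr ger0_norm //; lra.
by rewrite -[X in measurable X]setTI; exact: mB.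
Qed.

End gaussian_space.

Section positive_definite.
Context (R : realType).

Lemma unitmx_of_form_gt0 n (A : 'M[R]_n) :
  (forall x : 'cV[R]_n, x != 0 -> 0 < (x^T *m A *m x) 0 0) -> A \in unitmx.
Proof.
move=> Apos; rewrite unitmxE unitfE; apply/negP => /det0P[v v0 vA].
have := Apos v^T; rewrite trmxK vA mul0mx mxE ltxx.
by rewrite trmx_eq0 v0 => /(_ isT).
Qed.

Lemma invmx_posdef n (A : 'M[R]_n) : posdefmx A -> posdefmx (invmx A).
Proof.
move=> [symA Apos]; have uA := unitmx_of_form_gt0 Apos.
have symV : (invmx A)^T = invmx A by rewrite trmx_inv symA.
split=> // x x0.
have := Apos (invmx A *m x); rewrite trmx_mul symV -!mulmxA (mulmxA A) mulmxV // mul1mx.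
rewrite mulmxA; apply; apply: contra x0 => /eqP Ax.
by rewrite -[x]mul1mx -(mulmxV uA) -mulmxA Ax mulmx0.
Qed.

Lemma scale_posdef n (A : 'M[R]_n) (s : R) : 0 < s -> posdefmx A -> posdefmx (s *: A).
Proof.
move=> s0 [symA Apos]; split; first by apply/matrixP => i j; rewrite -[in RHS]symA !mxE.
by move=> x x0; rewrite -scalemxAr -scalemxAl mxE mulr_gt0 // Apos.
Qed.

Lemma post_precision_unit d p (H : 'M[R]_(p, d)) (Sigma : 'M[R]_d) (Gamma : 'M[R]_p) :
  posdefmx Sigma -> posdefmx Gamma ->
  invmx Sigma + H^T *m invmx Gamma *m H \in unitmx.
Proof.
move=> /invmx_posdef [_ Spos] /invmx_posdef [_ Gpos].
apply: unitmx_of_form_gt0 => x x0; rewrite mulmxDr mulmxDl mxE ltr_wpDr ?Spos //.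
rewrite !mulmxA -trmx_mul -!mulmxA mulmxA.
have [->|Hx0] := eqVneq (H *m x) 0; first by rewrite mulmx0 mxE.
by rewrite ltW // Gpos.
Qed.

End positive_definite.

(** * One step of the filter *)

Section filter_measurability.
Context (R : realType) (d p N : nat) (psi : {mfun 'cV[R]_d >-> 'cV[R]_d})
  (H : 'M[R]_(p, d)) (Sigma : 'M[R]_d) (Gamma : 'M[R]_p)
  (dT : measure_display) (T : measurableType dT).

Lemma measurable_gopf_step (y : 'cV[R]_p) (v : T -> N.-tuple 'cV[R]_d)
  (r : 'I_N -> T -> R) (zeta : 'I_N -> T -> 'cV[R]_d) :
  measurable_fun setT v -> (forall n, measurable_fun setT (r n)) ->
  (forall n, measurable_fun setT (zeta n)) ->
  measurable_fun setT (fun t => gopf_step psi H Sigma Gamma y (v t)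
    (fun n => r n t) (fun n => zeta n t)).
Proof.
move=> mv mr mz; apply/measurable_fun_tnthP => n; rewrite /comp.
under eq_fun do rewrite tnth_mktuple.
apply: measurable_addmx => //; apply: measurable_addmx => //.
by apply: measurable_mulmx; apply: measurableT_comp => //; exact: measurable_resample.
Qed.

(** The ensemble at time [k] depends only on the noise used before [k]. *)
Lemma measurable_gopf_past (y : nat -> 'cV[R]_p) z
  (r : nat -> 'I_N -> T -> R) (zeta : nat -> 'I_N -> T -> 'cV[R]_d) k :
  (forall j n, (j < k)%N -> measurable_fun setT (r j.+1 n)) ->
  (forall j n, (j < k)%N -> measurable_fun setT (zeta j n)) ->
  measurable_fun setT (fun t => gopf psi H Sigma Gamma y z
    (fun j n => r j n t) (fun j n => zeta j n t) k).
Proof.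
elim: k => [|k IHk] mr mz /=; first exact: measurable_cst.
apply: measurable_gopf_step.
- by apply: IHk => j n jk; [apply: mr|apply: mz]; rewrite ltnS ltnW.
- by move=> n; exact: mr.
- by move=> n; exact: mz.
Qed.

End filter_measurability.

(** The dominated probability [Lam] depends on the noise and on the common shift
    [s], but not on the means [m]. *)
Lemma ensemble_minorized (R : realType) (d N : nat) (dO : measure_display)
  (Omega : measurableType dO) (P : probability Omega R)
  (zeta : 'I_N -> Omega -> 'cV[R]_d) (c e L : R) (s : 'cV[R]_d) :
  (forall n, measurable_fun setT (zeta n)) ->
  (forall B : 'I_N -> set 'cV[R]_d, (forall n, measurable (B n)) ->
    P [set w | forall n, B n (zeta n w)] = (\prod_(n < N) P (zeta n @^-1` B n))%E) ->
  0 <= c -> 0 <= e <= c ^+ N ->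
  (forall n, exists Lam : probability 'cV[R]_d R,
    forall m : 'cV[R]_d, (forall i, `|m i 0| <= L) ->
    forall A, measurable A -> (c%:E * Lam A <= P [set w | A (m + zeta n w)%R])%E) ->
  exists Lam : probability (N.-tuple 'cV[R]_d) R,
  forall m : 'I_N -> 'cV[R]_d, (forall n i, `|m n i 0| <= L) ->
  forall h : N.-tuple 'cV[R]_d -> R, measurable_fun setT h ->
  (forall x, 0 <= h x <= 1) ->
  e * \int[Lam]_x h x <=
    \int[P]_w h [tuple m n + s + zeta n w | n < N] <=
  e * \int[Lam]_x h x + (1 - e).
Proof.
move=> mz indz c0 /andP[e0 ec] /choice[lam Hlam].
have mshift : measurable_fun setT (fun x : 'cV[R]_d => x + s).
  exact: measurable_addmx.
have /choice[lam' lam'E] : forall n, exists Lam : probability 'cV[R]_d R,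
    forall A, Lam A = lam n ((fun x => x + s) @^-1` A).
  by move=> n; have [Lam [LamE _]] := image_probability (lam n) mshift; exists Lam.
have [Lam HLam] := tuple_minorized lam' c0.
exists Lam => m mL h mh h01.
have mmz n : measurable_fun setT (fun w => m n + s + zeta n w).
  exact: measurable_addmx.
have /choice[mu muE] : forall n, exists mu : probability 'cV[R]_d R,
    forall A, mu A = P ((fun w => m n + s + zeta n w) @^-1` A).
  by move=> n; have [mu [muE _]] := image_probability P (mmz n); exists mu.
have mt : measurable_fun setT (fun w => [tuple m n + s + zeta n w | n < N]).
  apply/measurable_fun_tnthP => n; rewrite /comp.
  by under eq_fun do rewrite tnth_mktuple; exact: mmz.
have [rho [rhoE rhoint]] := image_probability P mt.
have -> : \int[P]_w h [tuple m n + s + zeta n w | n < N] = \int[rho]_x h x.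
  rewrite /Rintegral rhoint //; first exact/measurable_EFinP.
  by move=> x; rewrite lee_fin; have /andP[] := h01 x.
apply: minorized_integral => // A mA.
apply: (@le_trans _ _ ((c ^+ N)%:E * Lam A)%E).
  by apply: lee_wpmul2r; rewrite ?lee_fin // measure_ge0.
apply: (HLam mu) => //.
- move=> n B mB; rewrite lam'E muE.
  have mB' : measurable ((fun x => x + s) @^-1` B).
    by rewrite -[X in measurable X]setTI; exact: mshift.
  apply: le_trans (Hlam n (m n) (mL n) _ mB') _.
  rewrite le_eqVlt; apply/orP; left; apply/eqP; congr (P _).
  by apply/seteqP; split=> w /=; rewrite addrAC.
- move=> B mB; rewrite rhoE.
  pose B' n : set 'cV[R]_d := (fun x => m n + s + x) @^-1` B n.
  have mB' n : measurable (B' n).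
    by rewrite -[X in measurable X]setTI;
      apply: (@measurable_addmx _ _ _ _ _ (fun=> m n + s) id).
  transitivity (P [set w | forall n, B' n (zeta n w)]).
    congr (P _); apply/seteqP; split=> w /= Bw n.
      by have := Bw n; rewrite tnth_mktuple.
    by rewrite tnth_mktuple; exact: Bw.
  by rewrite indz //; apply: eq_bigr => n _; rewrite muE.
Qed.

(** * Contraction of Markov chains *)

Lemma unit_integral_bounds (R : realType) (d : measure_display) (T : measurableType d)
  (P : probability T R) (h : T -> R) (a b : R) : measurable_fun setT h ->
  (forall x, 0 <= h x <= 1) -> (forall x, a <= h x <= b) ->
  a <= \int[P]_x h x <= b.
Proof.
move=> mh h01 hab; have ih := unit_integrable P mh h01.
have cstE (c : R) : \int[P]_x c = c.
  by rewrite Rintegral_cst // [X in fine X](probability_setT P) mulr1.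
apply/andP; split; [rewrite -[leLHS]cstE|rewrite -[leRHS]cstE];
  apply: le_Rintegral => //;
  by [exact: finite_measure_integrable_cst|move=> x _; case/andP: (hab x)].
Qed.

Section markov.
Context (R : realType) (d d1 d2 : measure_display) (Omega : measurableType d)
  (S : measurableType d1) (T : measurableType d2) (P : probability Omega R).

(** Averaging over an independent noise [W] with the state frozen, then over the
    state. *)
Lemma unit_average (X : Omega -> S) (W : Omega -> T) (h : S * T -> R) :
  measurable_fun setT X -> measurable_fun setT W ->
  (forall A B, measurable A -> measurable B ->
    P (X @^-1` A `&` W @^-1` B) = (P (X @^-1` A) * P (W @^-1` B))%E) ->
  measurable_fun setT h -> (forall x, 0 <= h x <= 1) ->
  [/\ measurable_fun setT (fun x => \int[P]_w h (x, W w)),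
      forall x, 0 <= \int[P]_w h (x, W w) <= 1 &
      \int[P]_w h (X w, W w) = \int[P]_w \int[P]_w' h (X w, W w')].
Proof.
move=> mX mW ind mh h01.
have mhx x : measurable_fun setT (fun w => h (x, W w)).
  by apply: measurableT_comp => //; apply: measurable_fun_pair.
have avg01 x : 0 <= \int[P]_w h (x, W w) <= 1.
  exact: unit_integral_bounds.
have mavg : measurable_fun setT (fun x => \int[P]_w h (x, W w)).
  apply/measurable_EFinP.
  rewrite (_ : _ \o _ = fubini_F P (fun xw : S * Omega => (h (xw.1, W xw.2))%:E)).
    apply: measurable_fun_fubini_tonelli_F.
      apply/measurable_EFinP; apply: measurableT_comp => //.
      by apply: measurable_fun_pair => //; exact: measurableT_comp.
    by move=> x; rewrite lee_fin; case/andP: (h01 (x.1, W x.2)).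
  by apply/funext => x; rewrite /fubini_F /= -unit_integral_EFin.
split=> //; apply: EFin_inj; rewrite -unit_integral_EFin //; last first.
  by apply: measurableT_comp => //; exact: measurable_fun_pair.
rewrite (independent_integral mX mW ind (h := EFin \o h)) /=; last 2 first.
- exact/measurable_EFinP.
- by move=> x; rewrite lee_fin; case/andP: (h01 x).
rewrite -unit_integral_EFin //; last exact: (measurableT_comp mavg mX).
by apply: eq_integral => w _; rewrite -unit_integral_EFin.
Qed.

(** Two chains driven by the same maps and noise, each step erasing at least a
    fraction [e] of the dependence on the starting point. For [h] with values in
    [0, 1], the average [g] of [h] over one step ranges in an interval of length
    [1 - e], so [g = a + (1 - e) * f] with [f] again valued in [0, 1]; the
    induction hypothesis is applied to [f]. *)
Lemma doeblin_contraction (V V' : nat -> Omega -> S) (W : nat -> Omega -> T)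
  (Phi : nat -> S * T -> S) (e : R) : 0 <= e < 1 ->
  (forall k, measurable_fun setT (V k)) -> (forall k, measurable_fun setT (V' k)) ->
  (forall k, measurable_fun setT (W k)) -> (forall k, measurable_fun setT (Phi k)) ->
  (forall k A B, measurable A -> measurable B ->
    P (V k @^-1` A `&` W k @^-1` B) = (P (V k @^-1` A) * P (W k @^-1` B))%E) ->
  (forall k A B, measurable A -> measurable B ->
    P (V' k @^-1` A `&` W k @^-1` B) = (P (V' k @^-1` A) * P (W k @^-1` B))%E) ->
  (forall k w, V k.+1 w = Phi k (V k w, W k w)) ->
  (forall k w, V' k.+1 w = Phi k (V' k w, W k w)) ->
  (forall k (h : S -> R), measurable_fun setT h -> (forall x, 0 <= h x <= 1) ->
    exists a, forall v,
      a <= \int[P]_w h (Phi k (v, W k w)) <= a + (1 - e)) ->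
  forall k (h : S -> R), measurable_fun setT h -> (forall x, 0 <= h x <= 1) ->
  `|\int[P]_w h (V k w) - \int[P]_w h (V' k w)| <= (1 - e) ^+ k.
Proof.
move=> /andP[e0 e1] mV mV' mW mPhi indV indV' VS V'S dob.
elim=> [|k IHk] h mh h01.
  have i01 X : measurable_fun setT X -> 0 <= \int[P]_w h (X w) <= 1.
    by move=> mX; apply: unit_integral_bounds => //; exact: measurableT_comp.
  have := i01 _ (mV 0%N); have := i01 _ (mV' 0%N).
  by move=> /andP[? ?] /andP[? ?]; rewrite ler_norml; apply/andP; split; lra.
pose hPhi x := h (Phi k x).
have mhPhi : measurable_fun setT hPhi by exact: measurableT_comp.
have hPhi01 x : 0 <= hPhi x <= 1 by exact: h01.
have [mg g01 VE] := unit_average (mV k) (mW k) (indV k) mhPhi hPhi01.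
have [_ _ V'E] := unit_average (mV' k) (mW k) (indV' k) mhPhi hPhi01.
have [a ga] := dob k h mh h01.
pose g v := \int[P]_w h (Phi k (v, W k w)).
pose f v := (g v - a) / (1 - e).
have e10 : 0 < 1 - e by rewrite subr_gt0.
have mf : measurable_fun setT f.
  by apply: measurable_funM => //; apply: measurable_funB.
have f01 v : 0 <= f v <= 1.
  have /andP[ga1 ga2] := ga v.
  by rewrite divr_ge0 ?subr_ge0 ?(ltW e1) //= ler_pdivrMr // mul1r lerBlDl.
have avgE X : measurable_fun setT X ->
    \int[P]_w g (X w) = a + (1 - e) * \int[P]_w f (X w).
  move=> mX.
  have mfX : measurable_fun setT (fun w => f (X w)) by exact: measurableT_comp.
  have iX := unit_integrable P mfX (fun w => f01 (X w)).
  have -> : \int[P]_w g (X w) = \int[P]_w (a + (1 - e) * f (X w)).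
    apply: eq_Rintegral => w _; rewrite /f mulrC divfK ?gt_eqF //.
    by rewrite addrC subrK.
  rewrite RintegralD //; last 2 first.
  - exact: finite_measure_integrable_cst.
  - by have := integrableZl measurableT (1 - e) iX; apply: eq_integrable.
  by rewrite RintegralZl // Rintegral_cst // [X in fine X](probability_setT P) mulr1.
under eq_Rintegral do rewrite VS.
under [X in _ - X]eq_Rintegral do rewrite V'S.
rewrite -/(hPhi _) VE V'E !avgE //.
rewrite opprD addrACA subrr add0r -mulrBr normrM gtr0_norm // exprS.
by rewrite ler_wpM2l ?(ltW e10) // IHk.
Qed.

End markov.

(** * Total variation and geometric rates *)

(** Test functions with values in [0, 1] suffice: [h] bounded by 1 is
    [2 * g - 1] with [g] valued in [0, 1], and the factor 2 cancels the 1/2 in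
    the definition of the distance. *)
Lemma tv_dist_le (R : realType) (d : measure_display) (T : measurableType d)
  (mu nu : probability T R) (b : R) :
  (forall h : T -> R, measurable_fun setT h -> (forall x, 0 <= h x <= 1) ->
    `|\int[mu]_x h x - \int[nu]_x h x| <= b) ->
  0 <= tv_dist mu nu <= b.
Proof.
move=> hb; rewrite /tv_dist; set D := [set _ | _ in _].
have Db : ubound D (2 * b).
  move=> _ [h [mh h1] <-].
  pose g x := 2^-1 * (h x + 1).
  have mg : measurable_fun setT g.
    by apply: measurable_funM => //; exact: measurable_funD.
  have g01 x : 0 <= g x <= 1.
    have := h1 x; rewrite ler_norml => /andP[l1 l2].
    by apply/andP; split; rewrite /g; lra.
  have hE (P : probability T R) : \int[P]_x h x = 2 * \int[P]_x g x - 1.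
    have ig := unit_integrable P mg g01.
    have -> : \int[P]_x h x = \int[P]_x (2 * g x - 1).
      by apply: eq_Rintegral => x _; rewrite /g; lra.
    rewrite RintegralB //; last 2 first.
    - by have := integrableZl measurableT 2 ig; apply: eq_integrable.
    - exact: finite_measure_integrable_cst.
    by rewrite RintegralZl // Rintegral_cst // [X in fine X](probability_setT P) mulr1.
  rewrite !hE opprB addrA subrK -mulrBr normrM ger0_norm //.
  by rewrite ler_pM2l // hb.
have D0 : D 0.
  exists (fun=> 0); first by split => // x; rewrite normr0.
  by rewrite !Rintegral_cst // !mul0r subrr normr0.
apply/andP; split.
  by rewrite mulr_ge0 ?invr_ge0 //; apply: ub_le_sup => //; exists (2 * b).
rewrite mulrC ler_pdivrMr // mulrC; apply: ge_sup => //.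
by exists 0.
Qed.

Lemma limn_esup_root_le (R : realType) (u : nat -> R) (z : R) :
  0 <= z -> (forall k, 0 <= u k <= z ^+ k) ->
  (limn_esup (fun k => (u k `^ (k%:R)^-1)%:E) <= z%:E)%E.
Proof.
move=> z0 uz; rewrite limn_esup_lim; apply: lime_le; first exact: is_cvg_esups.
(* the term of index 0 has exponent [0^-1 = 0] and is not controlled, hence
   [n >= 1] *)
near=> n; apply: ge_ereal_sup => _ [k /= nk <-].
have k0 : (0 < k)%N by apply: leq_trans nk; near: n; exists 1%N.
have /andP[u0 uk] := uz k.
rewrite lee_fin (@le_trans _ _ ((z ^+ k) `^ (k%:R)^-1)) //.
  by rewrite ge0_ler_powR ?nnegrE // ?exprn_ge0 // invr_ge0.
by rewrite -powR_mulrn // -powRrM mulfV ?powRr1 // pnatr_eq0 -lt0n.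
Unshelve. all: by end_near. Qed.

(** * Contraction of the particle filter *)

Section filter_contraction.
Context (R : realType) (d p N : nat) (psi : {mfun 'cV[R]_d >-> 'cV[R]_d})
  (H : 'M[R]_(p, d)) (Sigma : 'M[R]_d) (Gamma : 'M[R]_p)
  (dO : measure_display) (Omega : measurableType dO) (P : probability Omega R)
  (r : nat -> 'I_N -> {RV P >-> R}) (zeta : nat -> 'I_N -> {RV P >-> 'cV[R]_d}).
Hypothesis indep : jointly_independent
  (fun kn : nat * 'I_N => r kn.1.+1 kn.2)
  (fun kn : nat * 'I_N => zeta kn.1 kn.2).

(* [inl (k, n)] and [inr (k, n)] index the uniform variable [r k.+1 n] and the
   Gaussian variable [zeta k n], both used in the step from time [k] to [k.+1] *)
Let index : eqType := ((nat * 'I_N) + (nat * 'I_N))%type.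

Let F (i : index) : set (set Omega) :=
  match i with
  | inl kn => g_sigma_algebra_preimage (r kn.1.+1 kn.2)
  | inr kn => g_sigma_algebra_preimage (zeta kn.1 kn.2)
  end.

Let time (i : index) : nat := match i with inl kn => kn.1 | inr kn => kn.1 end.

(* the noise of the step from time [k], and all the noise used before time [k] *)
Let Rs (k : nat) : seq index := [seq inl (k, n) | n <- enum 'I_N].
Let Zs (k : nat) : seq index := [seq inr (k, n) | n <- enum 'I_N].
Let past (k : nat) : seq index := flatten [seq Rs j ++ Zs j | j <- iota 0 k].

Let RsP k n : inl (k, n) \in Rs k.
Proof. by apply: map_f; rewrite mem_enum. Qed.

Let ZsP k n : inr (k, n) \in Zs k.
Proof. by apply: map_f; rewrite mem_enum. Qed.

Let time_now k i : i \in Rs k ++ Zs k -> time i = k.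
Proof. by rewrite mem_cat => /orP[] /mapP[n _ ->]. Qed.

Let time_past k i : i \in past k -> (time i < k)%N.
Proof.
by move=> /flatten_mapP[j]; rewrite mem_iota add0n => /andP[_ jk] /time_now ->.
Qed.

Let past_mem j k i : (j < k)%N -> i \in Rs j ++ Zs j -> i \in past k.
Proof. by move=> jk ij; apply/flatten_mapP; exists j => //; rewrite mem_iota. Qed.

Let FT i : F i setT.
Proof. by case: i => kn; exists setT => //; rewrite setTI. Qed.

Let Fm i : F i `<=` measurable.
Proof.
by case: i => kn A [B mB <-]; apply: measurable_funP.
Qed.

Let FI i : setI_closed (F i).
Proof.
by case: i => kn _ _ [A mA <-] [B mB <-]; exists (A `&` B);
  rewrite ?setTI //; exact: measurableI.
Qed.

Let indF : mutually_independent P F := indep.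

Let Rt k w : N.-tuple R := [tuple r k.+1 n w | n < N].
Let Zt k w : N.-tuple 'cV[R]_d := [tuple zeta k n w | n < N].
Let W k w := (Rt k w, Zt k w).

Let mRt s k : (forall n, inl (k, n) \in s) ->
  measurable_fun setT (Rt k : g_sigma_algebraType (cylinders F s) -> _).
Proof.
move=> ks; apply/measurable_fun_tnthP => n; rewrite /comp.
rewrite (_ : (fun _ => _) = r k.+1 n); last first.
  by apply/funext => w; rewrite tnth_mktuple.
exact: (measurable_cylinders_coord (i := inl (k, n)) FT (ks n)).
Qed.

Let mZt s k : (forall n, inr (k, n) \in s) ->
  measurable_fun setT (Zt k : g_sigma_algebraType (cylinders F s) -> _).
Proof.
move=> ks; apply/measurable_fun_tnthP => n; rewrite /comp.
rewrite (_ : (fun _ => _) = zeta k n); last first.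
  by apply/funext => w; rewrite tnth_mktuple.
exact: (measurable_cylinders_coord (i := inr (k, n)) FT (ks n)).
Qed.

Let mRtO k : measurable_fun [set: Omega] (Rt k).
Proof.
apply/measurable_fun_tnthP => n; rewrite /comp.
by under eq_fun do rewrite tnth_mktuple; exact: measurable_funP.
Qed.

Let mZtO k : measurable_fun [set: Omega] (Zt k).
Proof.
apply/measurable_fun_tnthP => n; rewrite /comp.
by under eq_fun do rewrite tnth_mktuple; exact: measurable_funP.
Qed.

Let mWO k : measurable_fun [set: Omega] (W k).
Proof. exact: measurable_fun_pair. Qed.

(* one step of the filter, as a function of the ensemble and of the noise *)
Let Phi (y : 'cV[R]_p) (x : N.-tuple 'cV[R]_d * (N.-tuple R * N.-tuple 'cV[R]_d)) :=
  gopf_step psi H Sigma Gamma y x.1 (tnth x.2.1) (tnth x.2.2).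

Let mPhi y : measurable_fun setT (Phi y).
Proof.
have ms : measurable_fun setT
    (fun x : N.-tuple 'cV[R]_d * (N.-tuple R * N.-tuple 'cV[R]_d) => x.2).
  exact: measurable_snd.
apply: (measurable_gopf_step psi H Sigma Gamma y
    (r := fun n x => tnth x.2.1 n) (zeta := fun n x => tnth x.2.2 n)).
- exact: measurable_fst.
- move=> n; apply: (measurableT_comp (measurable_tnth n)).
  exact: (measurableT_comp measurable_fst ms).
- move=> n; apply: (measurableT_comp (measurable_tnth n)).
  exact: (measurableT_comp measurable_snd ms).
Qed.

(* the ensemble at time [k] is independent of the noise of the next step *)
Let ensemble_past_noise y z k A B : measurable A -> measurable B ->
  P (gopf_ensemble psi H Sigma Gamma r zeta y k z @^-1` A `&` W k @^-1` B) =
  (P (gopf_ensemble psi H Sigma Gamma r zeta y k z @^-1` A) * P (W k @^-1` B))%E.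
Proof.
apply: (independent_functions Fm FT FI (s := past k) (t := Rs k ++ Zs k)) => //.
- by move=> i /time_past ik; apply/negP => /time_now ki; rewrite ki ltnn in ik.
- apply: measurable_gopf_past => j n jk.
    by apply: (measurable_cylinders_coord (i := inl (j, n)) FT) => //;
      apply: (past_mem jk); rewrite mem_cat RsP.
  by apply: (measurable_cylinders_coord (i := inr (j, n)) FT) => //;
    apply: (past_mem jk); rewrite mem_cat ZsP orbT.
- apply: measurable_fun_pair.
    by apply: mRt => n; rewrite mem_cat RsP.
  by apply: mZt => n; rewrite mem_cat ZsP orbT.
Qed.

(* within one step, resampling is independent of the Gaussian noise *)
Let resampling_noise k A B : measurable A -> measurable B ->
  P (Rt k @^-1` A `&` Zt k @^-1` B) = (P (Rt k @^-1` A) * P (Zt k @^-1` B))%E.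
Proof.
apply: (independent_functions Fm FT FI (s := Rs k) (t := Zs k)) => //.
- by move=> i /mapP[n _ ->]; apply/negP => /mapP[].
- by apply: mRt => n; exact: RsP.
- by apply: mZt => n; exact: ZsP.
Qed.

Let gaussian_noise k (B : 'I_N -> set 'cV[R]_d) : (forall n, measurable (B n)) ->
  P [set w | forall n, B n (zeta k n w)] = (\prod_(n < N) P (zeta k n @^-1` B n))%E.
Proof.
move=> mB.
pose E (i : index) := if i is inr kn then zeta k kn.2 @^-1` B kn.2 else setT.
have := indF (s := Zs k) (E := E).
rewrite big_map big_enum /= => <-.
- congr (P _); apply/seteqP; split=> w /=.
    by move=> Bw _ /mapP[n _ ->]; exact: Bw.
  by move=> Ew n; exact: (Ew _ (ZsP k n)).
- by rewrite map_inj_uniq ?enum_uniq // => n n' [].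
- by move=> _ /mapP[n _ ->] /=; exists (B n) => //; rewrite setTI.
Qed.

(** A geometric bound that is uniform in the data. *)
Lemma gopf_tv_bound : (exists M : R, forall x, enorm (psi x) <= M) ->
  posdefmx Sigma -> posdefmx Gamma ->
  (forall k n, centered_gaussian_law (post_cov H Sigma Gamma)
    (distribution P (zeta k n))) ->
  exists2 e : R, 0 < e < 1 & forall y k z z',
    0 <= tv_dist (gopf_law psi H Sigma Gamma r zeta y k z)
                 (gopf_law psi H Sigma Gamma r zeta y k z') <= (1 - e) ^+ k.
Proof.
move=> [M psiM] Spd Gpd zetaG.
pose A : 'M[R]_d := 1%:M - gain H Sigma Gamma *m H.
have M0 : 0 <= M by exact: le_trans (sqrtr_ge0 _) (psiM 0).
have psi_coord x j : `|psi x j 0| <= M.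
  apply: le_trans (psiM x); rewrite -sqrtr_sqr ler_wsqrtr //.
  by rewrite (bigD1 j) //= lerDl; apply: sumr_ge0 => i _; exact: sqr_ge0.
pose L : R := \sum_i \sum_j `|A i j| * M.
have mean_bound x i : `|(A *m psi x) i 0| <= L.
  rewrite mxE; apply: le_trans (ler_norm_sum _ _ _) _.
  apply: (@le_trans _ _ (\sum_j `|A i j| * M)).
    by apply: ler_sum => j _; rewrite normrM ler_wpM2l.
  rewrite /L [leRHS](bigD1 i) //= lerDl; apply: sumr_ge0 => i' _.
  by apply: sumr_ge0 => j _; rewrite mulr_ge0.
have [c /andP[c0 c1] Hc] := gaussian_minorized L (post_precision_unit H Spd Gpd).
(* half of [c ^+ N], so that [e < 1] also when [c = 1] (dimension 0) or [N = 0] *)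
pose e := c ^+ N / 2.
have cN0 : 0 < c ^+ N by rewrite exprn_gt0.
have cN1 : c ^+ N <= 1 by rewrite exprn_ile1 // ltW.
have e01 : 0 < e < 1 by apply/andP; split; rewrite /e; lra.
have ec : 0 <= e <= c ^+ N by apply/andP; split; rewrite /e; lra.
exists e => // y k z z'.
apply: tv_dist_le => h mh h01.
have lawE z1 : \int[gopf_law psi H Sigma Gamma r zeta y k z1]_x h x =
    \int[P]_w h (gopf_ensemble psi H Sigma Gamma r zeta y k z1 w).
  rewrite /Rintegral ge0_integral_distribution //; first exact/measurable_EFinP.
  by move=> x; rewrite lee_fin; have /andP[] := h01 x.
rewrite !lawE.
have stepE z1 j w : gopf_ensemble psi H Sigma Gamma r zeta y j.+1 z1 w =
    Phi (y j.+1) (gopf_ensemble psi H Sigma Gamma r zeta y j z1 w, W j w).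
  apply: eq_from_tnth => n; by rewrite !tnth_mktuple.
apply: (doeblin_contraction (e := e)
  (V := fun j => gopf_ensemble psi H Sigma Gamma r zeta y j z)
  (V' := fun j => gopf_ensemble psi H Sigma Gamma r zeta y j z')
  (W := W) (Phi := fun j => Phi (y j.+1))) => //.
- by case/andP: e01 => /ltW -> ->.
- by move=> j A1 B1; exact: ensemble_past_noise.
- by move=> j A1 B1; exact: ensemble_past_noise.
move=> j g mg g01.
pose s := gain H Sigma Gamma *m y j.+1.
have [|Lam HLam] := ensemble_minorized (P := P) s
    (fun n => @measurable_funP _ _ _ _ _ (zeta j n))
    (@gaussian_noise j) (ltW c0) ec (L := L).
  by move=> n; exact: Hc (zetaG j n).
exists (e * \int[Lam]_x g x) => v.
have mgPhi : measurable_fun setT (fun x => g (Phi (y j.+1) (v, x))).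
  apply: measurableT_comp => //; apply: measurableT_comp (mPhi _) _.
  exact: measurable_fun_pair.
have [mavg avg01 ->] := unit_average (mRtO j) (mZtO j) (@resampling_noise j) mgPhi
  (fun x => g01 _).
apply: unit_integral_bounds.
- exact: measurableT_comp mavg (mRtO j).
- by move=> w; exact: avg01.
move=> w.
pose m n := A *m psi (resample psi H Sigma Gamma (y j.+1) v (tnth (Rt j w) n)).
rewrite (_ : \int[P]_w' g (Phi (y j.+1) (v, (Rt j w, Zt j w'))) =
    \int[P]_w' g [tuple m n + s + zeta j n w' | n < N]).
  by apply: HLam => // n i; exact: mean_bound.
apply: eq_Rintegral => w' _; congr g; apply: eq_from_tnth => n.
rewrite !tnth_mktuple /=.
by rewrite /m tnth_mktuple.
Qed.

End filter_contraction.

Theorem theorem4p3 (R : realType) (d p : nat)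
  (psi : {mfun 'cV[R]_d >-> 'cV[R]_d}) (H : 'M[R]_(p, d))
  (psi_bounded : exists M : R, forall x, enorm (psi x) <= M)
  (sigma gamma : R) (sigma_gt0 : 0 < sigma) (gamma_gt0 : 0 < gamma)
  (Sigma0 : 'M[R]_d) (Gamma0 : 'M[R]_p)
  (Sigma0_pd : posdefmx Sigma0) (Gamma0_pd : posdefmx Gamma0)
  (u0 : 'cV[R]_d) (Sigma_star : 'M[R]_d) (Gamma_star : 'M[R]_p)
  (Sigma_star_psd : possemidefmx Sigma_star)
  (Gamma_star_psd : possemidefmx Gamma_star)
  (d1 : measure_display) (Omega : measurableType d1) (P : probability Omega R)
  (xi : nat -> {RV P >-> 'cV[R]_d}) (eta : nat -> {RV P >-> 'cV[R]_p})
  (xi_law : forall k, centered_gaussian_law Sigma_star (distribution P (xi k)))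
  (eta_law : forall k,
    centered_gaussian_law Gamma_star (distribution P (eta k.+1)))
  (data_indep : jointly_independent xi (fun k => eta k.+1))
  (N : nat) (N_ge1 : (1 <= N)%N)
  (d2 : measure_display) (Omega' : measurableType d2)
  (P' : probability Omega' R)
  (r : nat -> 'I_N -> {RV P' >-> R})
  (zeta : nat -> 'I_N -> {RV P' >-> 'cV[R]_d})
  (r_law : forall k n, uniform01_law (distribution P' (r k.+1 n)))
  (zeta_law : forall k n,
    centered_gaussian_law
      (post_cov H (sigma ^+ 2 *: Sigma0) (gamma ^+ 2 *: Gamma0))
      (distribution P' (zeta k n)))
  (filter_indep : jointly_independent
    (fun kn : nat * 'I_N => r kn.1.+1 kn.2)
    (fun kn : nat * 'I_N => zeta kn.1 kn.2))
  (z0 z0' : N.-tuple 'cV[R]_d) :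
  let y (w : Omega) (k : nat) : 'cV[R]_p :=
    observation psi H (sigma / gamma) gamma u0
      (fun j => xi j w) (fun j => eta j w) k in
  let q (w : Omega) (k : nat) (z : N.-tuple 'cV[R]_d) :=
    gopf_law psi H (sigma ^+ 2 *: Sigma0) (gamma ^+ 2 *: Gamma0)
      r zeta (y w) k z in
  exists zN : R, 0 < zN < 1 /\
    {ae P, forall w : Omega,
      (limn_esup (fun k : nat =>
        (tv_dist (q w k z0) (q w k z0') `^ (k%:R)^-1)%:E) <= zN%:E)%E}.
Proof.
move=> y q.
have Spd : posdefmx (sigma ^+ 2 *: Sigma0) by apply: scale_posdef; rewrite ?exprn_gt0.
have Gpd : posdefmx (gamma ^+ 2 *: Gamma0) by apply: scale_posdef; rewrite ?exprn_gt0.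
have [e /andP[e0 e1] He] := gopf_tv_bound filter_indep psi_bounded Spd Gpd zeta_law.
exists (1 - e); split; first by apply/andP; split; lra.
apply: aeW => w; apply: limn_esup_root_le; first by rewrite subr_ge0 ltW.
by move=> k; exact: He.
Qed.
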